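(* Let $\mathcal{B}_{\mathcal G}$ be the set of partitions $\lambda=(\lambda_1>\lambda_2>\cdots>\lambda_\ell)$ into distinct positive parts such that $1\le\lambda_{2i-1}-\lambda_{2i}\le2$ whenever $2i\le\ell$, $\lambda_{2i}-\lambda_{2i+1}=2$ whenever $2i+1\le\ell$, and the smallest part $\lambda_\ell$ is $1$ or $2$, with $\lambda_\ell=2$ required when $\ell$ is even. For a partition let $|\lambda_o|=\lambda_1+\lambda_3+\lambda_5+\cdots$ and $|\lambda_e|=\lambda_2+\lambda_4+\cdots$. For integers $n,h$ let $B_G(n,h)=\sum x^{|\lambda_o|}y^{|\lambda_e|}$, the sum over all $\lambda\in\mathcal{B}_{\mathcal G}$ with exactly $n$ parts and largest part $h$. Then for all integers $n\ge1$ and $h\ge0$, $$B_G(2n-1,3n+h-2)=x^{\frac{3n^2-n}{2}+\frac{h^2+h}{2}}y^{\frac{3n^2-3n}{2}+\frac{h^2-h}{2}}{n\brack h}_{xy},\qquad B_G(2n,3n+h)=x^{\frac{3n^2+3n}{2}+\frac{h^2+h}{2}}y^{\frac{3n^2+n}{2}+\frac{h^2-h}{2}}{n\brack h}_{xy}.$$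
   Context: The Gaussian coefficient is ${a+b\brack b}_t=\frac{(t;t)_{a+b}}{(t;t)_a(t;t)_b}$ if $a,b\ge0$ and $0$ otherwise, with $(a;t)_n=\prod_{i=0}^{n-1}(1-at^i)$; here $t=xy$. *)

(* Defs.v *)
From mathcomp Require Import all_boot all_order all_algebra.
From mathcomp Require Import mpoly.

Set Implicit Arguments.
Unset Strict Implicit.
Unset Printing Implicit Defensive.

Import GRing.Theory.
Local Open Scope ring_scope.

Definition part (lam : seq nat) (i : nat) : nat := nth 0%N lam i.-1.

(* The differences below are truncated natural-number subtractions; this is
   harmless because the parts are required to decrease. *)
Definition in_BG (lam : seq nat) : bool :=
  let l := size lam in
  [&& sorted gtn lam,
      all (leq 1) lam,
      [forall i : 'I_l.+1, (1 <= i)%N && (2 * i <= l)%N ==>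
         (1 <= part lam (2 * i - 1) - part lam (2 * i) <= 2)%N],
      [forall i : 'I_l.+1, (1 <= i)%N && (2 * i + 1 <= l)%N ==>
         (part lam (2 * i) - part lam (2 * i + 1) == 2)%N],
      (part lam l == 1%N) || (part lam l == 2%N)
    & ~~ odd l ==> (part lam l == 2%N)].

Definition osum (lam : seq nat) : nat :=
  (\sum_(1 <= i < (size lam).+1 | odd i) part lam i)%N.

Definition esum (lam : seq nat) : nat :=
  (\sum_(1 <= i < (size lam).+1 | ~~ odd i) part lam i)%N.

Definition X : {mpoly int[2]} := 'X_(0 : 'I_2).
Definition Y : {mpoly int[2]} := 'X_(1 : 'I_2).

(* A partition with largest part h has all its parts at most h, so tuples over
   'I_h.+1 range over all the candidates. *)
Definition BG (n h : nat) : {mpoly int[2]} :=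
  \sum_(lam : n.-tuple 'I_h.+1
         | in_BG (map val lam) && (part (map val lam) 1 == h))
     X ^+ osum (map val lam) * Y ^+ esum (map val lam).

Definition qpoch (F : fieldType) (a t : F) (n : nat) : F :=
  \prod_(i < n) (1 - a * t ^+ i).

Definition gauss (F : fieldType) (t : F) (n h : nat) : F :=
  if (h <= n)%N then qpoch t t n / (qpoch t t (n - h) * qpoch t t h) else 0.

(* BG does not depend on the finite encoding of its range of summation. *)
Lemma BGE (n h : nat) (r : seq (seq nat)) :
  uniq r ->
  (forall lam, (lam \in r) = [&& in_BG lam, size lam == n & part lam 1 == h]) ->
  BG n h = \sum_(lam <- r) X ^+ osum lam * Y ^+ esum lam.
Proof.
move=> r_uniq rE; rewrite /BG.
pose f (lam : n.-tuple 'I_h.+1) := map val lam.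
have f_inj : injective f by move=> u v /(inj_map val_inj)/val_inj.
rewrite -big_filter -(big_map f predT (fun lam => X ^+ osum lam * Y ^+ esum lam)).
apply: perm_big; apply: uniq_perm => //.
  by rewrite map_inj_uniq // filter_uniq // index_enum_uniq.
move=> lam; rewrite rE; apply/mapP/and3P.
  case=> u; rewrite mem_filter => /andP[/andP[uB uh] _] ->; split=> //.
  by rewrite size_map size_tuple.
case=> lamB /eqP lamn lamh.
have lam_le : all (fun k => k < h.+1)%N lam.
  case/and3P: (lamB) => lam_s _ _; move: lamh lam_s; rewrite /part /=.
  case: (lam) => [//|a s] /= /eqP <-; rewrite leqnn /=.
  move/(order_path_min (fun y x z xy yz => ltn_trans yz xy)).
  by apply: sub_all => k /= /ltnW.
have sz : size (map (@inord h) lam) == n by rewrite size_map lamn.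
have fE : f (Tuple sz) = lam.
  rewrite /f /= -map_comp -[RHS]map_id; apply/eq_in_map => k /(allP lam_le) kh /=.
  by rewrite inordK.
exists (Tuple sz) => //.
by rewrite mem_filter mem_index_enum andbT -/(f _) fE lamB.
Qed.

(* Main.v *)
(* A partition in B_G is built from the bottom two parts at a time, with two
   choices at each step. Removing the two largest parts therefore gives a
   two-term recurrence for B_G in which the parity of the number of parts does
   not change; after the monomial prefactors are divided out it becomes the
   Pascal rule [n+1, h+1] = t^(h+1) [n, h+1] + [n, h] with t = xy. The recurrence
   is the same for both parities, and only the initial terms differ: one part,
   equal to 1 or 2, or two parts, (3, 2) or (4, 2). *)
Require Import Defs.
From mathcomp Require Import all_boot all_order all_algebra.
From mathcomp Require Import mpoly.
From mathcomp Require Import zify ring.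

Import GRing.Theory.
Local Open Scope ring_scope.

(** * Membership in B_G and the two largest parts *)

(** Zero-based indices and the additive form of the gap 2 suit induction on lists. The default 0 of
    [last] excludes the empty list. *)
Lemma in_BGP (lam : seq nat) :
  reflect [/\ sorted gtn lam, all (leq 1) lam,
     forall i, (2 * i + 2 <= size lam)%N ->
       (1 <= nth 0%N lam (2 * i) - nth 0%N lam (2 * i + 1) <= 2)%N,
     forall i, (2 * i + 3 <= size lam)%N ->
       nth 0%N lam (2 * i + 1) = (nth 0%N lam (2 * i + 2) + 2)%N
   & (last 0%N lam == 2%N) || odd (size lam) && (last 0%N lam == 1%N)]
  (in_BG lam).
Proof.
rewrite /in_BG /part nth_last; apply: (iffP and5P).
  move=> [-> -> /forallP H1 /forallP H2 /andP[H3 H4]]; split=> //.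
  - move=> i hi; have hi' : (i.+1 < (size lam).+1)%N by lia.
    have h2i : (2 * i.+1 <= size lam)%N by lia.
    have := implyP (H1 (Ordinal hi')) (introT andP (conj isT h2i)).
    by congr (1 <= nth _ _ _ - nth _ _ _ <= 2)%N; rewrite [nat_of_ord _]/=; lia.
  - move=> i hi; have hi' : (i.+1 < (size lam).+1)%N by lia.
    have h2i : (2 * i.+1 + 1 <= size lam)%N by lia.
    have : (nth 0%N lam (2 * i.+1).-1 - nth 0%N lam (2 * i.+1 + 1).-1 == 2)%N.
      exact: implyP (H2 (Ordinal hi')) (introT andP (conj isT h2i)).
    have -> : ((2 * i.+1).-1 = 2 * i + 1)%N by lia.
    have -> : ((2 * i.+1 + 1).-1 = 2 * i + 2)%N by lia.
    by lia.
  - by move: H3 H4; case: (odd _); case: eqP => //=; case: eqP.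
move=> [-> -> H1 H2 H3]; split=> //.
- apply/forallP => i; apply/implyP => /andP[i1 il].
  have hi : (2 * i.-1 + 2 <= size lam)%N by lia.
  move: (H1 _ hi); congr (1 <= nth _ _ _ - nth _ _ _ <= 2)%N; lia.
- apply/forallP => i; apply/implyP => /andP[i1 il].
  have hi : (2 * i.-1 + 3 <= size lam)%N by lia.
  have -> : ((2 * i).-1 = 2 * i.-1 + 1)%N by lia.
  have -> : ((2 * i + 1).-1 = 2 * i.-1 + 2)%N by lia.
  by rewrite (H2 _ hi) addKn.
- by move: H3; case: (odd _); case: eqP => //=; case: eqP.
Qed.

Lemma in_BG_seq1 (a : nat) : in_BG [:: a] = (a == 1%N) || (a == 2%N).
Proof.
apply/in_BGP/idP => [[_ _ _ _] /=|/=]; first by rewrite orbC.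
move=> ha; split=> //=; [lia| lia | move=> i; lia | by rewrite orbC].
Qed.

Lemma in_BG_seq2 (a b : nat) :
  in_BG [:: a; b] = (b == 2%N) && ((a == 3%N) || (a == 4%N)).
Proof.
apply/in_BGP/idP => [[_ _ H _] /=|/= /andP[/eqP -> ha]].
  by rewrite orbF => /eqP hb; move: (H 0%N isT) => /=; lia.
split=> //=; [lia|lia|case=> [|i]; rewrite /=; lia|move=> i; lia].
Qed.

(** Dropping two parts preserves the parity of the length and of every remaining index, so only the
    gaps [a - b] and [b - c] are new conditions. *)
Lemma in_BG_cons2 (a b c : nat) (mu : seq nat) :
  in_BG [:: a, b, c & mu] =
    [&& (a == c + 3)%N || (a == c + 4)%N, b == (c + 2)%N & in_BG (c :: mu)].
Proof.
apply/in_BGP/and3P.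
  case=> /= /and3P[ab bc s] /and3P[_ _ p] H1 H2 H3.
  have hb : b = (c + 2)%N by exact: (H2 0%N).
  have := H1 0%N isT => /= ha; split; [lia|exact/eqP|].
  apply/in_BGP; split=> //=.
  - move=> i hi; have := H1 i.+1; rewrite (_ : 2 * i.+1 = (2 * i).+2)%N; last lia.
    by rewrite /= => -> //; lia.
  - move=> i hi; have := H2 i.+1; rewrite (_ : 2 * i.+1 = (2 * i).+2)%N; last lia.
    by rewrite /= => -> //; lia.
  - by move: H3; rewrite negbK.
case=> ha /eqP hb /in_BGP[/= s p H1 H2 H3]; split.
- by rewrite /= s; lia.
- by rewrite /= p; lia.
- case=> [_|i hi]; first by rewrite /=; lia.
  rewrite (_ : 2 * i.+1 = (2 * i).+2)%N; last lia.
  by apply: H1; move: hi => /=; lia.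
- case=> [_|i hi]; first by rewrite /= hb.
  rewrite (_ : 2 * i.+1 = (2 * i).+2)%N; last lia.
  by apply: H2; move: hi => /=; lia.
- by rewrite /= negbK.
Qed.

(** * Weights and enumeration *)

Lemma osum_cons2 (a b : nat) (mu : seq nat) :
  osum [:: a, b & mu] = (a + osum mu)%N.
Proof.
rewrite /osum /= big_mkcond big_nat_recl // big_nat_recl //= add0n.
congr (_ + _)%N; rewrite [RHS]big_mkcond; apply: eq_big_nat => -[//|i] _.
by rewrite /= negbK.
Qed.

Lemma esum_cons2 (a b : nat) (mu : seq nat) :
  esum [:: a, b & mu] = (b + esum mu)%N.
Proof.
rewrite /esum /= big_mkcond big_nat_recl // big_nat_recl //= add0n.
congr (_ + _)%N; rewrite [RHS]big_mkcond; apply: eq_big_nat => -[//|i] _.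
by rewrite /= negbK.
Qed.

Lemma osum_nil : osum [::] = 0%N. Proof. by rewrite /osum big_geq. Qed.
Lemma esum_nil : esum [::] = 0%N. Proof. by rewrite /esum big_geq. Qed.
Lemma osum_seq1 (a : nat) : osum [:: a] = a.
Proof. by rewrite /osum big_mkcond big_nat1. Qed.
Lemma esum_seq1 (a : nat) : esum [:: a] = 0%N.
Proof. by rewrite /esum big_mkcond big_nat1. Qed.

(** Provides the list that [BGE] asks for when none can be written down explicitly. *)
Lemma BG_enum (n h : nat) : exists2 r : seq (seq nat), uniq r &
  forall lam, (lam \in r) = [&& in_BG lam, size lam == n & part lam 1 == h].
Proof.
pose P lam := [&& in_BG lam, size lam == n & part lam 1 == h].
exists (filter P (undup
  [seq map val (u : n.-tuple 'I_h.+1) | u <- enum {: n.-tuple 'I_h.+1}])).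
  by rewrite filter_uniq // undup_uniq.
move=> lam; rewrite mem_filter mem_undup -/(P lam) andb_idr //.
case/and3P=> lamB lamn lamh.
have lam_le : all (fun k => k < h.+1)%N lam.
  case/in_BGP: lamB lamh => s _ _ _ _; case: (lam) s => //= a s.
  move/(order_path_min (fun y x z xy yz => ltn_trans yz xy)) => s_lt /eqP <-.
  by rewrite leqnn; apply: sub_all s_lt => k /= /ltnW.
have sz : size (map (@inord h) lam) == n by rewrite size_map.
apply/mapP; exists (Tuple sz); rewrite ?mem_enum // -map_comp.
rewrite -[LHS]map_id; apply/eq_in_map => k /(allP lam_le) kh /=.
by rewrite inordK.
Qed.

(** * Initial terms and recurrence *)

Lemma BG1 (m : nat) : BG 1 m = if (m == 1%N) || (m == 2%N) then X ^+ m else 0.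
Proof.
rewrite (@BGE 1 m (if (m == 1%N) || (m == 2%N) then [:: [:: m]] else [::])).
- by case: ifP => _; rewrite ?big_nil // big_seq1 osum_seq1 esum_seq1 mulr1.
- by case: ifP.
case=> [|a [|b s]] /=; rewrite ?andbF;
  try by case: ifP => _; rewrite ?inE ?eqseq_cons ?andbF.
rewrite in_BG_seq1 /part /=; have [->|am] := eqVneq a m; case: ifP => // _.
- by rewrite inE eqxx.
- by rewrite inE eqseq_cons (negbTE am) andbF.
- by rewrite andbF.
Qed.

Lemma BG2 (m : nat) :
  BG 2 m = if (m == 3%N) || (m == 4%N) then X ^+ m * Y ^+ 2 else 0.
Proof.
rewrite (@BGE 2 m (if (m == 3%N) || (m == 4%N) then [:: [:: m; 2%N]] else [::])).
- case: ifP => _; rewrite ?big_nil // big_seq1 osum_cons2 esum_cons2.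
  by rewrite osum_nil esum_nil !addn0.
- by case: ifP.
case=> [|a [|b [|c s]]] /=; rewrite ?andbF;
  try by case: ifP => _; rewrite ?inE ?eqseq_cons ?andbF.
rewrite in_BG_seq2 /part /=; have [->|am] := eqVneq a m; case: ifP => // _.
- by rewrite inE !eqseq_cons eqxx !andbT.
- by rewrite andbF.
- by rewrite inE eqseq_cons (negbTE am) andbF.
- by rewrite andbF.
Qed.

(** The largest part exceeds the third, which is positive, by at least 3. *)
Lemma BG_small (n m : nat) : (m < 4)%N -> BG n.+3 m = 0.
Proof.
move=> m4; rewrite (@BGE n.+3 m [::]) ?big_nil // => -[|a [|b [|c mu]]];
  rewrite ?andbF // in_nil; apply/esym/negbTE/negP.
rewrite in_BG_cons2 => /and3P[/and3P[ha _ /in_BGP[_ /= /andP[hc _] _ _ _]] _].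
by rewrite /part /= => /eqP hm; lia.
Qed.

(* Stripping the two largest parts: they are [c + 3] or [c + 4], and [c + 2],
   where [c] is the third part. *)
Lemma BG_rec (n m : nat) :
  BG n.+3 m.+4 = X ^+ m.+4 * (Y ^+ m.+3 * BG n.+1 m.+1 + Y ^+ m.+2 * BG n.+1 m).
Proof.
have [r1 u1 E1] := BG_enum n.+1 m.+1; have [r0 u0 E0] := BG_enum n.+1 m.
pose f k (mu : seq nat) := [:: m.+4, k & mu].
have f_inj k : injective (f k) by move=> u v [].
(* The third part is [m.+1] or [m]; the second part, 2 larger, keeps the two lists disjoint. *)
rewrite (@BGE _ _ (map (f m.+3) r1 ++ map (f m.+2) r0)) ?(BGE u1 E1) ?(BGE u0 E0).
- rewrite big_cat !big_map mulrDr !mulr_sumr /=.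
  congr (_ + _); apply: eq_bigr => mu _; rewrite osum_cons2 esum_cons2 !exprD.
    by rewrite mulrACA -!mulrA; congr (_ * _); rewrite mulrCA.
  by rewrite mulrACA -!mulrA; congr (_ * _); rewrite mulrCA.
- rewrite cat_uniq !map_inj_uniq // u1 u0 andbT /=.
  apply/hasPn => _ /mapP[mu _ ->]; apply/mapP => -[nu _ [e _]]; lia.
move=> lam; rewrite mem_cat; apply/orP/and3P.
  case=> /mapP[mu]; rewrite ?E1 ?E0 => /and3P[muB mun muh] ->;
    (case: mu muB mun muh => // c mu; rewrite /part in_BG_cons2 /= => -> mun /eqP ->;
     split=> //; rewrite andbT; lia).
case: lam => [|a [|b [|c mu]]] [] //.
rewrite /part in_BG_cons2 /= => /and3P[ha /eqP hb cB] mun /eqP am.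
have [hc|hc] : c = m.+1 \/ c = m by lia.
- left; apply/mapP; exists (c :: mu); last by rewrite /f hb; congr [:: _, _ & _]; lia.
  by rewrite E1 cB /part /= hc eqxx andbT.
- right; apply/mapP; exists (c :: mu); last by rewrite /f hb; congr [:: _, _ & _]; lia.
  by rewrite E0 cB /part /= hc eqxx andbT.
Qed.

(** * Gaussian coefficients over a field *)

Section Gauss.
Variables (F : fieldType) (t : F).
(** Makes the denominators in [gauss] nonzero. *)
Hypothesis t_nonroot : forall i, 1 - t ^+ i.+1 != 0.

Lemma qpochS (n : nat) : qpoch t t n.+1 = qpoch t t n * (1 - t ^+ n.+1).
Proof. by rewrite /qpoch big_ord_recr exprS. Qed.

Lemma qpoch_neq0 (n : nat) : qpoch t t n != 0.
Proof. by elim: n => [|n IH]; rewrite ?qpochS ?mulf_neq0 // /qpoch big_ord0 oner_eq0. Qed.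

Lemma gauss0 (n : nat) : gauss t n 0 = 1.
Proof.
by rewrite /gauss leq0n subn0 {3}/qpoch big_ord0 mulr1 divff ?qpoch_neq0.
Qed.

Lemma gauss_gt (n h : nat) : (n < h)%N -> gauss t n h = 0.
Proof. by move=> nh; rewrite /gauss leqNgt nh. Qed.

Lemma gauss_nn (n : nat) : gauss t n n = 1.
Proof.
by rewrite /gauss leqnn subnn {2}/qpoch big_ord0 mul1r divff ?qpoch_neq0.
Qed.

(** For [n = h + k + 1], clearing common factors leaves 1 - t^(h+k+2) = t^(h+1) (1 - t^(k+1)) + (1 -
    t^(h+1)). *)
Lemma gaussS (n h : nat) :
  gauss t n.+1 h.+1 = t ^+ h.+1 * gauss t n h.+1 + gauss t n h.
Proof.
have [nh|hn|->] := ltngtP n h.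
- by rewrite !gauss_gt ?mulr0 ?addr0 // ltnW.
- have [k ->] : exists k, n = (h + k).+1 by exists (n - h.+1)%N; lia.
  have gaussE m i : gauss t (i + m) i = qpoch t t (i + m) / (qpoch t t m * qpoch t t i).
    by rewrite /gauss leq_addr addKn.
  have -> : gauss t (h + k).+2 h.+1 = gauss t (h.+1 + k.+1) h.+1 by rewrite addSn addnS.
  have -> : gauss t (h + k).+1 h = gauss t (h + k.+1) h by rewrite addnS.
  rewrite -addSn !gaussE addSn !addnS !qpochS.
  have -> : t ^+ (h + k).+2 = t ^+ h.+1 * t ^+ k.+1 by rewrite -exprD addSn addnS.
  have := t_nonroot h; have := t_nonroot k.
  have := qpoch_neq0 h; have := qpoch_neq0 k.
  move: (qpoch t t h) (qpoch t t k) (t ^+ h.+1) (t ^+ k.+1) => a b c d *.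
  by field; repeat (apply/andP; split).
- by rewrite !gauss_nn gauss_gt ?mulr0 ?add0r.
Qed.

End Gauss.

(** * Closed form of the recurrence *)

(* The initial term is supported on [c + 1] and [c + 2], and each step raises
   the least index of the support by 3, so [c.+1 + 3 * k] is the least index. *)
Lemma pascal_solution (F : fieldType) (x y : F) (c d : nat) (B : nat -> nat -> F) :
  (forall i, 1 - (x * y) ^+ i.+1 != 0) ->
  (forall m, (m <= c)%N -> B 0 m = 0) ->
  (forall h, B 0 (c.+1 + h)%N =
     x ^+ (c.+1 + 'C(h.+1, 2)) * y ^+ (d + 'C(h, 2)) * gauss (x * y) 1 h) ->
  (forall k m, (m < 4)%N -> B k.+1 m = 0) ->
  (forall k m, B k.+1 m.+4 =
     x ^+ m.+4 * (y ^+ m.+3 * B k m.+1 + y ^+ m.+2 * B k m)) ->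
  forall k h, B k (3 * k + c.+1 + h)%N =
     x ^+ (c.+1 + (3 * 'C(k, 2) + (c + 4) * k) + 'C(h.+1, 2))
     * y ^+ (d + (3 * 'C(k, 2) + (c + 3) * k) + 'C(h, 2)) * gauss (x * y) k.+1 h.
Proof.
move=> nonroot B0 B0h Bsmall BS.
(* The recurrence lowers the index by 3 or 4 and the bound by 3, so vanishing propagates. *)
have Bz k m : (m <= 3 * k + c)%N -> B k m = 0.
  elim: k m => [|k IH] m hm; first by apply: B0; lia.
  have [m4|] := ltnP m 4; first exact: Bsmall.
  case: m hm => [|[|[|[|m]]]] // hm _.
  by rewrite BS !IH ?mulr0 ?addr0 ?mulr0 //; lia.
elim=> [|k IH] h; first by rewrite bin0n !muln0 !addn0 B0h.
have -> : (3 * k.+1 + c.+1 + h = (3 * k + c + h).+4)%N by lia.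
rewrite BS (_ : (3 * k + c + h).+1 = 3 * k + c.+1 + h)%N; last lia.
have monoE i j a b g : x ^+ i * (y ^+ j * (x ^+ a * y ^+ b * g)) =
    x ^+ (i + a) * y ^+ (j + b) * g.
  by rewrite !exprD; ring.
have monoE' i j a b g : x ^+ i * y ^+ j * (x ^+ a * y ^+ b * g) =
    x ^+ (i + a) * y ^+ (j + b) * g.
  by rewrite -mulrA monoE.
have bin2S m : 'C(m.+1, 2) = ('C(m, 2) + m)%N by rewrite binS bin1.
(* At [h = 0] only the first term survives, and the step multiplies by x^(3k+c+4) y^(3k+c+3).
   Summing these exponents over the steps gives the terms in [k] of the closed form. *)
case: h => [|h].
  rewrite IH Bz ?addn0 // mulr0 addr0 monoE !gauss0 //.
  by congr (_ ^+ _ * _ ^+ _ * _); rewrite bin2S; lia.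
rewrite IH (_ : 3 * k + c + h.+1 = 3 * k + c.+1 + h)%N; last lia.
(* The prefactors of the two terms have ratio (xy)^(h+1), the power of t in the Pascal rule. *)
rewrite IH [in RHS]gaussS // exprMn !mulrDr monoE' !monoE.
by congr (_ ^+ _ * _ ^+ _ * _ + _ ^+ _ * _ ^+ _ * _); rewrite !bin2S; lia.
Qed.

(** * The fraction field and the two parities *)

(** Evaluation at the origin sends the polynomial to 1. *)
Lemma tofracXY_nonroot (i : nat) :
  1 - tofrac (X * Y) ^+ i.+1 != 0 :> {fraction {mpoly int[2]}}.
Proof.
rewrite -tofrac1 -tofracXn -tofracB tofrac_eq0; apply/eqP.
move/(congr1 (meval (fun _ => 0 : int))); rewrite rmorphB rmorphXn rmorphM rmorph1 rmorph0 /=.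
by rewrite /X mevalXU mul0r expr0n subr0.
Qed.

Lemma BG_frac_rec (n m : nat) :
  tofrac (BG n.+3 m.+4) = tofrac X ^+ m.+4 *
    (tofrac Y ^+ m.+3 * tofrac (BG n.+1 m.+1) + tofrac Y ^+ m.+2 * tofrac (BG n.+1 m)).
Proof. by rewrite BG_rec tofracM tofracXn tofracD tofracM tofracXn tofracM tofracXn. Qed.

Theorem theorem5p3 (n h : nat) (hn : (1 <= n)%N) :
  tofrac (BG (2 * n - 1) (3 * n + h - 2)) =
    tofrac (X ^+ ((3 * n ^ 2 - n) %/ 2 + (h ^ 2 + h) %/ 2)
     * Y ^+ ((3 * n ^ 2 - 3 * n) %/ 2 + (h ^ 2 - h) %/ 2))
    * gauss (tofrac (X * Y)) n h
  /\
  tofrac (BG (2 * n) (3 * n + h)) =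
    tofrac (X ^+ ((3 * n ^ 2 + 3 * n) %/ 2 + (h ^ 2 + h) %/ 2)
     * Y ^+ ((3 * n ^ 2 + n) %/ 2 + (h ^ 2 - h) %/ 2))
    * gauss (tofrac (X * Y)) n h.
Proof.
(* Writing squares through binomials makes all the halved exponents linear for [lia]. *)
have bin2_double m : (m * m = 2 * 'C(m, 2) + m)%N.
  by elim: m => // m IH; rewrite binS bin1; lia.
have halfE a b : a = (2 * b)%N -> (a %/ 2 = b)%N by move=> ->; rewrite mulKn.
have hp : ((h ^ 2 + h) %/ 2 = 'C(h.+1, 2))%N.
  by apply: halfE; rewrite binS bin1; have := bin2_double h; rewrite -mulnn; lia.
have hm : ((h ^ 2 - h) %/ 2 = 'C(h, 2))%N.
  by apply: halfE; have := bin2_double h; rewrite -mulnn; lia.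
case: n hn => // k _; have kk := bin2_double k.
have nonroot i : 1 - (tofrac X * tofrac Y) ^+ i.+1 != 0 :> {fraction {mpoly int[2]}}.
  by rewrite -tofracM tofracXY_nonroot.
have gauss_ge2 i : (1 < i)%N -> gauss (tofrac X * tofrac Y) 1 i = 0 by exact: gauss_gt.
rewrite hp hm !tofracM !tofracXn; split.
- have -> : (2 * k.+1 - 1 = (2 * k).+1)%N by lia.
  have -> : (3 * k.+1 + h - 2 = 3 * k + 1 + h)%N by lia.
  (* A single part is at least 1, so [c = 0]; there is no second part, so [d = 0]. *)
  rewrite (@pascal_solution _ (tofrac X) (tofrac Y) 0 0
    (fun j m => tofrac (BG (2 * j).+1 m))) //.
  + by congr (_ ^+ _ * _ ^+ _ * _); congr addn; apply/esym/halfE; rewrite -!mulnn; lia.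
  + by case=> // _; rewrite BG1 tofrac0.
  + case=> [|[|i]]; rewrite BG1 /=.
    * by rewrite gauss0 // mulr1 tofracXn expr0 mulr1.
    * by rewrite gauss_nn // mulr1 tofracXn expr0 mulr1.
    * by rewrite gauss_ge2 // mulr0 tofrac0.
  + by move=> j m m4; rewrite mulnS BG_small // tofrac0.
  + by move=> j m; rewrite mulnS BG_frac_rec.
- have -> : (2 * k.+1 = (2 * k).+2)%N by lia.
  have -> : (3 * k.+1 + h = 3 * k + 3 + h)%N by lia.
  (* For (3, 2) and (4, 2) the least largest part is 3, so [c = 2]; the second part gives
     [d = 2]. *)
  rewrite (@pascal_solution _ (tofrac X) (tofrac Y) 2 2
    (fun j m => tofrac (BG (2 * j).+2 m))) //.
  + by congr (_ ^+ _ * _ ^+ _ * _); congr addn; apply/esym/halfE; rewrite -!mulnn; lia.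
  + by case=> [|[|[|m]]] // _; rewrite BG2 tofrac0.
  + case=> [|[|i]]; rewrite BG2 /=.
    * by rewrite gauss0 // mulr1 tofracM 2!tofracXn.
    * by rewrite gauss_nn // mulr1 tofracM 2!tofracXn.
    * by rewrite gauss_ge2 // mulr0 tofrac0.
  + by move=> j m m4; rewrite mulnS BG_small // tofrac0.
  + by move=> j m; rewrite mulnS BG_frac_rec.
Qed.
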